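(* Consider the action of $\tilde\Gamma_{\mathrm{pol}}^{\mathrm{lev}}$ by right multiplication on the set of primitive vectors of $\mathbb{Z}^{2g}$. A set of representatives for the orbits of this action (each orbit being represented exactly once) is given by the primitive vectors of the form $$\tilde v=(D_{1:g-1},\,D_{2:g-1}a_2,\,D_{3:g-1}a_3,\dots,a_g,\,0,\,D_{2:g-1}a_{g+2},\,D_{3:g-1}a_{g+3},\dots,a_{2g})$$ (the displayed $0$ being the $(g+1)$st entry), where $(D_1,\dots,D_{g-1})$ runs through all tuples of positive integers satisfying $D_i\mid d_i$ for all $i$ and $\gcd\big(\tfrac{d_i}{D_i},D_j\big)=1$ for all $1\le i<j\le g-1$, and where the $a_i,a_{g+i}$ are integers with $$0\le a_i<D_{1:i-1},\qquad 0\le a_{g+i}<D_{1:i-1}\qquad\text{for } i=2,\dots,g.$$ Here $D_{i:j}=\prod_{n=i}^{j}D_n$ for $i\le j$ and $D_{i:j}=1$ for $i>j$.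
   Context: Let $g$ be a positive integer and $d_1,\dots,d_{g-1}$ positive integers. Put $d_{i:j}=\prod_{n=i}^{j}d_n$ for $i\le j$ and $d_{i:j}=1$ for $i>j$. The polarisation type is $(1,d_1,d_{1:2},\dots,d_{1:g-1})$; let $\Delta=\operatorname{diag}(1,d_1,d_{1:2},\dots,d_{1:g-1})$ and $\Lambda=\begin{pmatrix}0&\Delta\\-\Delta&0\end{pmatrix}$. Vectors are row vectors, $\langle x,y\rangle=x\Lambda\,{}^t y$, $L=\mathbb{Z}^{2g}$, and $L^\vee=\{y\in L\otimes\mathbb{Q}:\langle x,y\rangle\in\mathbb{Z}\text{ for all }x\in L\}$. The groups are $$\tilde\Gamma_{\mathrm{pol}}=\{M\in \mathrm{SL}(2g,\mathbb{Z}): M\Lambda\,{}^tM=\Lambda\},\qquad \tilde\Gamma_{\mathrm{pol}}^{\mathrm{lev}}=\{M\in\tilde\Gamma_{\mathrm{pol}}: M \text{ acts as the identity on } L^\vee/L\},$$ acting on row vectors by right multiplication. A vector of $\mathbb{Z}^{2g}$ is primitive if the gcd of its entries is $1$. (Each line in $\mathbb{Q}^{2g}$ is isotropic and spanned by a primitive vector.) *)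

(* Defs.v *)
From mathcomp Require Import all_boot all_order all_algebra.

Set Implicit Arguments.
Unset Strict Implicit.
Unset Printing Implicit Defensive.

Import Order.TTheory GRing.Theory Num.Theory.
Local Open Scope ring_scope.

(* Families d_1, ..., d_(g-1) and D_1, ..., D_(g-1) are functions on nat,
   read with the 1-based indices of the text; only their values at
   1, ..., g-1 are ever used.  An ordinal i : 'I_g stands for the 1-based
   index i.+1. *)

(* d_{i:j}, equal to 1 when i > j *)
Definition range_prod (d : nat -> nat) (i j : nat) : nat :=
  (\prod_(i <= n < j.+1) d n)%N.

Definition Delta (g : nat) (d : nat -> nat) : 'M[int]_g :=
  diag_mx (\row_(i < g) (range_prod d 1 i)%:Z).

Definition Lambda (g : nat) (d : nat -> nat) : 'M[int]_(g + g) :=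
  block_mx 0 (Delta g d) (- Delta g d) 0.

(* The form <x, y> on L (x) Q = Q^(2g). *)
Definition pairing (g : nat) (d : nat -> nat) (x y : 'rV[rat]_(g + g)) : rat :=
  (x *m map_mx intr (Lambda g d) *m y^T) 0 0.

(* L = Z^(2g) inside L (x) Q *)
Definition in_lattice (g : nat) (y : 'rV[rat]_(g + g)) : Prop :=
  y \is a mxOver Num.int.

Definition in_dual (g : nat) (d : nat -> nat) (y : 'rV[rat]_(g + g)) : Prop :=
  forall x : 'rV[rat]_(g + g), in_lattice x -> pairing d x y \is a Num.int.

Definition Gamma_pol (g : nat) (d : nat -> nat) (M : 'M[int]_(g + g)) : Prop :=
  \det M = 1 /\ M *m Lambda g d *m M^T = Lambda g d.

Definition Gamma_pol_lev (g : nat) (d : nat -> nat) (M : 'M[int]_(g + g)) :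
    Prop :=
  Gamma_pol d M /\
  forall y : 'rV[rat]_(g + g), in_dual d y -> in_lattice (y *m map_mx intr M - y).

Definition primitive (n : nat) (v : 'rV[int]_n) : Prop :=
  \big[gcdn/0%N]_(i < n) absz (v 0 i) = 1%N.

Definition same_orbit (g : nat) (d : nat -> nat) (v w : 'rV[int]_(g + g)) :
    Prop :=
  exists2 M : 'M[int]_(g + g), Gamma_pol_lev d M & w = v *m M.

Definition admissible (g : nat) (d D : nat -> nat) : Prop :=
  (forall i : nat, (1 <= i <= g.-1)%N -> (0 < D i)%N /\ (D i %| d i)%N) /\
  (forall i j : nat, (1 <= i)%N -> (i < j)%N -> (j <= g.-1)%N ->
     gcdn (d i %/ D i) (D j) = 1%N).

(* The function a carries a_2, ..., a_g and a_(g+2), ..., a_(2g); its other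
   values are not used. *)
Definition rep_vector (g : nat) (D : nat -> nat) (a : nat -> int) :
    'rV[int]_(g + g) :=
  row_mx
    (\row_(i < g) if (i == 0 :> nat)%N then (range_prod D 1 g.-1)%:Z
                  else (range_prod D i.+1 g.-1)%:Z * a i.+1)
    (\row_(i < g) if (i == 0 :> nat)%N then 0
                  else (range_prod D i.+1 g.-1)%:Z * a (g + i.+1)%N).

Definition is_rep (g : nat) (d : nat -> nat) (v : 'rV[int]_(g + g)) : Prop :=
  primitive v /\
  exists (D : nat -> nat) (a : nat -> int),
    [/\ admissible g d D,
        forall i : nat, (2 <= i <= g)%N ->
          0 <= a i < (range_prod D 1 i.-1)%:Z /\
          0 <= a (g + i)%N < (range_prod D 1 i.-1)%:Z
      & v = rep_vector g D a].

(* Main.v *)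
Require Import Defs.
From mathcomp Require Import all_boot all_order all_algebra.
From mathcomp Require Import ring zify.

(* Let div(v) > 0 generate the ideal <v, L>.  The level group preserves div(v)
   and, as v / div(v) lies in the dual lattice, the class of v modulo div(v).
   Conversely it contains the transvection x |-> x + c <x, u> u for every
   u in L.  Write v = a e + b f + z with e, f the hyperbolic pair of indices 1
   and g+1 and z orthogonal to it.  Transvections along e and f act on (a, b) as
   SL(2, Z), and Eichler transvections (e or f with u orthogonal to both) trade
   b for <z, u>; together they bring v to div(v) e + z', where z' can be replaced
   by any vector congruent to z modulo div(v).  So an orbit has a unique member
   with entry 1 equal to D = div(v), entry g+1 equal to 0 and all other entries
   in [0, D).  These are exactly the listed representatives: the conditions on
   the D_i force D_{1:i} = gcd(D, d_{1:i}), and D | d_{1:i} v_{i+1} then gives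
   the divisibility of the entries. *)

Set Implicit Arguments.
Unset Strict Implicit.
Unset Printing Implicit Defensive.

Import Order.TTheory GRing.Theory Num.Theory.
Local Open Scope ring_scope.

(** * Rank-one updates of the identity and contents of integer vectors *)

Lemma det_rank1_update (R : comPzRingType) (n : nat) (a : 'cV[R]_n)
    (b : 'rV[R]_n) : b *m a = 0 -> \det (1%:M + a *m b) = 1.
Proof.
move=> ba0; pose B := block_mx 1%:M (- a) b (1%:M : 'M_1).
(* Two block triangular factorizations of [B]; the first needs [b *m a = 0] and gives determinant 1,
   the second gives the determinant sought. *)
have B1 : B = block_mx 1%:M 0 b 1%:M *m block_mx 1%:M (- a) 0 1%:M.
  by rewrite mulmx_block !(mul1mx, mul0mx, mulmx1, mulmx0, addr0, add0r)
             mulmxN ba0 oppr0 add0r.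
have B2 : B = block_mx 1%:M (- a) 0 1%:M *m block_mx (1%:M + a *m b) 0 b 1%:M.
  by rewrite mulmx_block !(mul1mx, mul0mx, mulmx1, mulmx0, addr0, add0r)
             mulNmx addrK.
have := congr1 determinant B2.
by rewrite {1}B1 !det_mulmx !det_ublock !det_lblock !det1 !mul1r mulr1.
Qed.

(** Same expression as in [primitive], so [primitive w] unfolds to [content w = 1]. *)
Definition content (n : nat) (w : 'rV[int]_n) : nat :=
  \big[gcdn/0%N]_(i < n) absz (w 0 i).

Lemma dvdn_content (n k : nat) (w : 'rV[int]_n) :
  (k %| content w)%N <-> forall i, (k %| (w 0 i)%R)%Z.
Proof.
split=> [/dvdn_biggcdP h i | h]; first exact: h.
by apply/dvdn_biggcdP=> i _; exact: h.
Qed.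

Lemma content_bezout (n : nat) (w : 'rV[int]_n) :
  exists u : 'rV[int]_n, (w *m u^T) 0 0 = (content w)%:Z.
Proof.
rewrite /content; elim/big_ind: _ => [|x y [u wu] [v wv]|i _].
- by exists 0; rewrite trmx0 mulmx0 mxE.
- have [k [l klE]] := Bezoutz x y; exists (k *: u + l *: v).
  rewrite linearD !linearZ /= mulmxDr -!scalemxAr mxE [X in X + _]mxE.
  by rewrite [X in _ + X]mxE wu wv klE.
- exists (sgz (w 0 i) *: delta_mx 0 i).
  rewrite linearZ /= -scalemxAr trmx_delta -colE mxE mxE.
  by rewrite -abszEsg.
Qed.

(** * The integral form and transvections in the level group *)

Section Form.

Variables (g : nat) (d : nat -> nat).
Implicit Types (u v w x y z e f : 'rV[int]_(g + g)) (M N : 'M[int]_(g + g)).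

Definition form x y : int := (x *m Lambda g d *m y^T) 0 0.

Lemma Lambda_tr : (Lambda g d)^T = - Lambda g d.
Proof.
rewrite /Lambda tr_block_mx opp_block_mx !trmx0 !oppr0 linearN /=.
by rewrite /Delta tr_diag_mx opprK.
Qed.

Lemma formDl x y z : form (x + y) z = form x z + form y z.
Proof. by rewrite /form !mulmxDl mxE. Qed.

Lemma formZl c x z : form (c *: x) z = c * form x z.
Proof. by rewrite /form -!scalemxAl mxE. Qed.

Lemma form_skew x y : form x y = - form y x.
Proof.
have -> : form y x = (y *m Lambda g d *m x^T)^T 0 0 by rewrite [RHS]mxE.
rewrite !trmx_mul trmxK Lambda_tr mulNmx mulmxN mulmxA.
by rewrite [in RHS]mxE opprK.
Qed.

Lemma formDr x y z : form z (x + y) = form z x + form z y.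
Proof. by rewrite form_skew formDl opprD -!form_skew. Qed.

Lemma formZr c x z : form z (c *: x) = c * form z x.
Proof. by rewrite form_skew formZl -mulrN -form_skew. Qed.

Lemma formxx x : form x x = 0.
Proof. by have := form_skew x x; lia. Qed.

Definition formE := (formDl, formDr, formZl, formZr, formxx).

Lemma form_Gamma_pol M x y :
  Gamma_pol d M -> form (x *m M) (y *m M) = form x y.
Proof.
by case=> _ MLM; rewrite /form trmx_mul !mulmxA -[in RHS]MLM !mulmxA.
Qed.

Lemma in_latticeD (x y : 'rV[rat]_(g + g)) :
  in_lattice x -> in_lattice y -> in_lattice (x + y).
Proof.
by move=> /mxOverP xZ /mxOverP yZ; apply/mxOverP=> i j; rewrite mxE rpredD.
Qed.

Lemma in_lattice_mul m (x : 'M[rat]_(1, m)) (N : 'M[int]_(m, g + g)) :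
  x \is a mxOver Num.int -> in_lattice (x *m map_mx intr N).
Proof.
move=> /mxOverP xZ; apply/mxOverP=> i j; rewrite mxE; apply: rpred_sum=> k _.
by apply: rpredM; [exact: xZ | rewrite mxE; exact: intr_int].
Qed.

Lemma Gamma_pol_lev_mul M N :
  Gamma_pol_lev d M -> Gamma_pol_lev d N -> Gamma_pol_lev d (M *m N).
Proof.
move=> [[dM sM] lM] [[dN sN] lN]; split; first split.
- by rewrite det_mulmx dM dN mulr1.
- by rewrite trmx_mul !mulmxA -(mulmxA M) -(mulmxA M) sN.
move=> y yd; have -> : y *m map_mx intr (M *m N) - y =
    (y *m map_mx intr M - y) *m map_mx intr N + (y *m map_mx intr N - y).
  by rewrite map_mxM mulmxA mulmxBl addrA subrK.
apply: in_latticeD; last exact: lN.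
exact/in_lattice_mul/lM.
Qed.

Lemma same_orbit_trans w v z :
  same_orbit d v w -> same_orbit d w z -> same_orbit d v z.
Proof.
move=> [M lM ->] [N lN ->]; exists (M *m N); last by rewrite mulmxA.
exact: Gamma_pol_lev_mul.
Qed.

(** The matrix is 1 plus a rank-one term. It preserves the form because [form u u = 0], and it is
    trivial on the discriminant group because a dual vector pairs integrally with [u], hence moves
    by an integer multiple of [u]. *)
Lemma same_orbit_transvection c u v :
  same_orbit d v (v + (c * form v u) *: u).
Proof.
have uu0 : u *m Lambda g d *m u^T = 0.
  by apply/matrixP=> i j; rewrite !ord1 [RHS]mxE -[LHS]/(form u u) formxx.
exists (1%:M + (c *: (Lambda g d *m u^T)) *m u); last first.
  rewrite mulmxDr mulmx1 -scalemxAl -scalemxAr !mulmxA.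
  by rewrite [v *m _ *m _]mx11_scalar mul_scalar_mx scalerA.
split; first split.
- by apply: det_rank1_update; rewrite -scalemxAr mulmxA uu0 scaler0.
- set X := Lambda g d *m u^T; have uX0 : u *m X = 0 by rewrite mulmxA.
  have LA : Lambda g d *m ((c *: X) *m u)^T = - ((c *: X) *m u *m Lambda g d).
    rewrite trmx_mul linearZ /= trmx_mul trmxK Lambda_tr mulmxA -/X.
    by rewrite mulmxN scalerN mulmxN -scalemxAr -!scalemxAl !mulmxA.
  rewrite -mulmxA linearD /= trmx1 mulmxDr mulmx1 LA mulmxDl mul1mx mulmxBr.
  rewrite -(mulmxA _ u (Lambda g d)) -(mulmxA _ u (_ *m _)) (mulmxA u (c *: X)).
  by rewrite -scalemxAr uX0 scaler0 mul0mx mulmx0 subr0 subrK.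
move=> y yd; rewrite map_mxD map_mx1 mulmxDr mulmx1 addrC addKr.
rewrite map_mxM mulmxA; apply: in_lattice_mul.
rewrite map_mxZ -scalemxAr.
apply/mxOverP=> i j; rewrite !ord1 mxE; apply: rpredM; first exact: intr_int.
have /yd uy : in_lattice (map_mx intr u : 'rV[rat]_(g + g)).
  by apply/mxOverP=> k l; rewrite mxE; exact: intr_int.
rewrite map_mxM -map_trmx mulmxA -[y *m _ *m _]trmxK mxE !trmx_mul trmxK.
by rewrite map_trmx Lambda_tr map_mxN mulNmx mulmxN mxE rpredN mulmxA.
Qed.

Lemma same_orbit_refl v : same_orbit d v v.
Proof. by have := same_orbit_transvection 0 0 v; rewrite mul0r scaler0 addr0. Qed.

(** Transvect along [e + u], then backwards along [e] and along [u]: as [e] and [u] are orthogonal,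
    only the cross terms survive. *)
Lemma same_orbit_eichler e u v : form e u = 0 ->
  same_orbit d v (v + form v e *: u + form v u *: e).
Proof.
move=> eu0; have ue0 : form u e = 0 by rewrite form_skew eu0 oppr0.
apply: same_orbit_trans (same_orbit_transvection 1 (e + u) v) _.
apply: same_orbit_trans (same_orbit_transvection (-1) e _) _.
set v' := (X in same_orbit d X _).
suff -> : v + form v e *: u + form v u *: e = v' + (-1 * form v' u) *: u.
  exact: same_orbit_transvection.
rewrite /v' !formE eu0 ue0.
by apply/rowP=> i; rewrite !mxE; ring.
Qed.

(** * Moves attached to a hyperbolic pair *)

Section Plane.

Variables e f : 'rV[int]_(g + g).
Hypothesis ef1 : form e f = 1.

Lemma fe1 : form f e = -1. Proof. by rewrite form_skew ef1. Qed.

Variable z : 'rV[int]_(g + g).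
Hypotheses (ze0 : form z e = 0) (zf0 : form z f = 0).

Lemma same_orbit_addr a b c :
  same_orbit d (a *: e + b *: f + z) (a *: e + (b + c * a) *: f + z).
Proof.
have := same_orbit_transvection c f (a *: e + b *: f + z).
rewrite !formE ef1 zf0; congr (same_orbit _ _ _).
by apply/rowP=> i; rewrite !mxE; ring.
Qed.

Lemma same_orbit_addl a b c :
  same_orbit d (a *: e + b *: f + z) ((a + c * b) *: e + b *: f + z).
Proof.
have := same_orbit_transvection (- c) e (a *: e + b *: f + z).
rewrite !formE fe1 ze0; congr (same_orbit _ _ _).
by apply/rowP=> i; rewrite !mxE; ring.
Qed.

(** A quarter turn as a product of three elementary matrices of SL(2, Z). *)
Lemma same_orbit_rot a b :
  same_orbit d (a *: e + b *: f + z) (b *: e + (- a) *: f + z).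
Proof.
apply: same_orbit_trans (same_orbit_addl a b 1) _.
apply: same_orbit_trans (same_orbit_addr _ b (-1)) _.
apply: same_orbit_trans (same_orbit_addl _ _ 1) _.
have -> : a + 1 * b + 1 * (b + -1 * (a + 1 * b)) = b by ring.
have -> : b + -1 * (a + 1 * b) = - a by ring.
exact: same_orbit_refl.
Qed.

(** Euclid's algorithm by induction on [|b|]: each division is followed by a quarter turn. *)
Lemma same_orbit_gcd a b :
  same_orbit d (a *: e + b *: f + z) (gcdz a b *: e + 0 *: f + z).
Proof.
have [n] := ubnP `|b|%N; elim: n => // n IHn in a b *; rewrite ltnS => leb.
have [-> | b0] := eqVneq b 0; last first.
  have := same_orbit_addl a b (- (a %/ b)%Z).
  have -> : a + - (a %/ b)%Z * b = (a %% b)%Z by rewrite /modz; ring.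
  move=> /same_orbit_trans; apply.
  apply: same_orbit_trans (same_orbit_rot _ _) _.
  have -> : gcdz a b = gcdz b (- (a %% b)%Z).
    by rewrite gcdzN gcdzC gcdz_modr.
  apply: IHn; rewrite abszN; apply: leq_trans leb.
  by have := ltz_mod a b0; have := modz_ge0 a b0; lia.
rewrite gcdz0; have [a0 | a0] := leP 0 a.
  by rewrite gez0_abs //; exact: same_orbit_refl.
(* Two quarter turns negate [a], since [gcdz] is nonnegative. *)
apply: same_orbit_trans (same_orbit_rot _ _) _.
apply: same_orbit_trans (same_orbit_rot _ _) _.
by rewrite oppr0 ltz0_abs //; exact: same_orbit_refl.
Qed.

(** The Eichler move for the pair [f], [u]; here the vector pairs to [a] with [f] and to [form z u]
    with [u]. *)
Lemma same_orbit_shift a b u : form u e = 0 -> form u f = 0 ->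
  same_orbit d (a *: e + b *: f + z) (a *: e + (b + form z u) *: f + (z + a *: u)).
Proof.
move=> ue0 uf0.
have fu0 : form f u = 0 by rewrite form_skew uf0 oppr0.
have eu0 : form e u = 0 by rewrite form_skew ue0 oppr0.
have := same_orbit_eichler (a *: e + b *: f + z) fu0.
rewrite !formE ef1 fu0 eu0 zf0; congr (same_orbit _ _ _).
by apply/rowP=> i; rewrite !mxE; ring.
Qed.

End Plane.

(** * The divisor and the class modulo it: invariance and completeness *)

Definition divisor v : nat := content (v *m Lambda g d).

Lemma divisor_attained v : exists x, form v x = (divisor v)%:Z.
Proof. exact: content_bezout. Qed.

Lemma divisor_dvd v x : (divisor v %| form v x)%Z.
Proof.
have /dvdn_content h := dvdnn (divisor v).
by rewrite /form mxE; apply: rpred_sum => i _; apply/dvdz_mulr/h.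
Qed.

Lemma divisor_orbit v w : same_orbit d v w -> divisor w = divisor v.
Proof.
move=> [M [MG _] ->]; apply/eqP; rewrite eqn_dvd; apply/andP; split.
  have [x vx] := divisor_attained v.
  by have := divisor_dvd (v *m M) (x *m M); rewrite form_Gamma_pol // vx.
have [x vMx] := divisor_attained (v *m M).
have := divisor_dvd v (x *m invmx M).
rewrite -(form_Gamma_pol _ _ MG) -mulmxA mulVmx ?mulmx1 ?vMx //.
by rewrite unitmxE MG.1 unitr1.
Qed.

Lemma pairing_intr x y : pairing d (map_mx intr x) (map_mx intr y) = (form x y)%:~R.
Proof. by rewrite /pairing map_trmx -!map_mxM mxE. Qed.

Lemma orbit_congr v w : (0 < divisor v)%N -> same_orbit d v w ->
  exists r, w = v + (divisor v)%:Z *: r.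
Proof.
set D := divisor v => D0 [M [_ lM] ->].
have DQ0 : (D%:Z%:~R : rat) != 0 by rewrite intr_eq0; lia.
(* [y = v / D] is dual, so [M] moves it by a lattice vector; multiplying by [D] gives the
   congruence. [Num.floor] only reads integral rationals as integers. *)
pose y : 'rV[rat]_(g + g) := D%:Z%:~R^-1 *: map_mx intr v.
have /lM /mxOverP yM : in_dual d y.
  move=> x /mxOverP xZ.
  have -> : x = map_mx intr (map_mx (@Num.floor rat) x).
    by apply/matrixP=> i j; rewrite !mxE floorK.
  rewrite /pairing /y linearZ /= -scalemxAr mxE -/(pairing d _ _) pairing_intr.
  rewrite form_skew; have /dvdzP[k ->] := divisor_dvd v (map_mx Num.floor x).
  by rewrite -/D -mulNr intrM mulrC mulfK // intr_int.
exists (map_mx (@Num.floor rat) (y *m map_mx intr M - y)).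
apply/rowP=> i; apply: (intr_inj (R := rat)).
rewrite [in RHS]mxE intrD [X in _ + X%:~R]mxE intrM [X in _ * X%:~R]mxE floorK //.
by rewrite -scalemxAl -map_mxM !mxE mulrBr !mulVKf // addrC subrK.
Qed.

(** Euclid in the plane gives [h e + z]; a shift and Euclid again lower [h] to [D]; a last shift
    matches the orthogonal part of [w], and the coefficient of [f] is then cleared. *)
Lemma orbit_reduce e f v w r : form e f = 1 -> (0 < divisor v)%N ->
    w = v + (divisor v)%:Z *: r ->
    form w f = (divisor v)%:Z -> form w e = 0 ->
  same_orbit d v w.
Proof.
move=> ef1; set D := divisor v => D0 wE wf we.
have fe1 := fe1 ef1.
set a := form v f; set b := - form v e.
have [z zE] : exists z, z = v - a *: e - b *: f by eexists.
have ze : form z e = 0 by rewrite zE -!scaleNr !formE fe1 /b; ring.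
have zf : form z f = 0 by rewrite zE -!scaleNr !formE ef1 /a; ring.
have vE : v = a *: e + b *: f + z by rewrite zE; apply/rowP=> i; rewrite !mxE; ring.
have := same_orbit_gcd ef1 ze zf a b; rewrite -vE.
set h := gcdz a b => v1.
have Dv1 := divisor_orbit v1.
have [x xE] := divisor_attained (h *: e + 0 *: f + z).
rewrite Dv1 -/D in xE.
(* The projection of [x] orthogonal to the plane. Since [h * form e x + form z u = D], the gcd of
   [h] and [form z u] divides [D]. *)
have [u uE] : exists u, u = x - form x f *: e + form x e *: f by eexists.
have ue : form u e = 0 by rewrite uE -!scaleNr !formE fe1; ring.
have uf : form u f = 0 by rewrite uE -!scaleNr !formE ef1; ring.
have Dh : (D %| h)%Z.
  rewrite dvdz_gcd; apply/andP; split; first exact: divisor_dvd.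
  by rewrite /b rpredN; exact: divisor_dvd.
have /(same_orbit_trans v1) v2 := same_orbit_shift ef1 zf h 0 ue uf.
have [z2 z2E] : exists z2, z2 = z + h *: u by eexists.
rewrite -z2E in v2.
have z2e : form z2 e = 0 by rewrite z2E !formE ze ue; ring.
have z2f : form z2 f = 0 by rewrite z2E !formE zf uf; ring.
have := same_orbit_gcd ef1 z2e z2f h (0 + form z u).
have zux : form z u = form z x.
  by rewrite uE -!scaleNr !formE ze zf; ring.
have -> : gcdz h (0 + form z u) = D.
  rewrite add0r /gcdz; congr Posz; apply/eqP; rewrite eqn_dvd; apply/andP; split.
    suff : (gcdz h (form z u) %| D%:Z)%Z by [].
    rewrite -xE !formDl !formZl mul0r addr0 -zux rpredD ?dvdz_gcdr //.
    by rewrite dvdz_mulr ?dvdz_gcdl.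
  suff : (D %| gcdz h (form z u))%Z by [].
  rewrite dvdz_gcd Dh /=.
  have := divisor_dvd (h *: e + 0 *: f + z) u; rewrite Dv1 -/D.
  by rewrite !formDl !formZl (form_skew e) (form_skew f) ue uf oppr0 !mulr0 !add0r.
move=> /(same_orbit_trans v2) v3.
have Dv3 := divisor_orbit v3.
have [a' aE] := dvdzP (divisor_dvd v f : (D %| a)%Z).
have /dvdzP [b' bE] : (D %| b)%Z by rewrite /b rpredN; exact: divisor_dvd.
have [h' hE] := dvdzP Dh.
(* Solves [w = D e + z2 + D t], using that [D] divides [a], [b] and [h]. *)
have [t tD] : exists t, t = r - e + a' *: e + b' *: f - h' *: u by eexists.
have tE : w = D%:Z *: e + 0 *: f + (z2 + D%:Z *: t).
  rewrite wE tD z2E zE -/a -/b aE bE hE.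
  by apply/rowP=> i; rewrite !mxE; ring.
have Dn0 : D%:Z != 0 by lia.
have te : form t e = 0.
  apply: (mulfI Dn0); move: we; rewrite tE !formE z2e fe1; lia.
have tf : form t f = 0.
  apply: (mulfI Dn0); move: wf; rewrite tE !formE z2f ef1; lia.
have /(same_orbit_trans v3) v4 := same_orbit_shift ef1 z2f D 0 te tf.
(* The shift leaves [form z2 t] as coefficient of [f], a multiple of the coefficient [D] of [e], so
   it can be cleared. *)
have /dvdzP[k kE] : (D %| form z2 t)%Z.
  have := divisor_dvd (D%:Z *: e + 0 *: f + z2) t; rewrite Dv3 -/D.
  by rewrite !formDl !formZl (form_skew e) (form_skew f) te tf oppr0 !mulr0 !add0r.
have z4f : form (z2 + D%:Z *: t) f = 0 by rewrite !formE z2f tf; ring.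
apply: same_orbit_trans v4 _.
have := same_orbit_addr ef1 z4f D (0 + form z2 t) (- k).
by rewrite kE add0r mulNr subrr -tE.
Qed.

End Form.

(** * Products over index ranges *)

Lemma range_prod10 (d : nat -> nat) : range_prod d 1 0 = 1%N.
Proof. by rewrite /range_prod big_geq. Qed.

Lemma range_prod1S (d : nat -> nat) (i : nat) :
  range_prod d 1 i.+1 = (range_prod d 1 i * d i.+1)%N.
Proof. by rewrite /range_prod big_nat_recr. Qed.

Lemma range_prod_cat (d : nat -> nat) (i j : nat) : (i <= j)%N ->
  range_prod d 1 j = (range_prod d 1 i * range_prod d i.+1 j)%N.
Proof. by move=> leij; rewrite /range_prod (big_cat_nat (n := i.+1)). Qed.

Lemma range_prod_gt0 (d : nat -> nat) (n i : nat) :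
    (forall i, (1 <= i <= n)%N -> (0 < d i)%N) -> (i <= n)%N ->
  (0 < range_prod d 1 i)%N.
Proof.
move=> d0; elim: i => [|i IHi] lein; first by rewrite range_prod10.
by rewrite range_prod1S muln_gt0 IHi ?d0 // ltnW.
Qed.

Lemma range_prod_dvd (d D : nat -> nat) (n i : nat) :
    (forall i, (1 <= i <= n)%N -> (D i %| d i)%N) -> (i <= n)%N ->
  (range_prod D 1 i %| range_prod d 1 i)%N.
Proof.
move=> dvd; elim: i => [|i IHi] lein; first by rewrite !range_prod10.
by rewrite !range_prod1S dvdn_mul ?IHi ?dvd // ltnW.
Qed.

(** * Recovering the tuple of the D_i from their product D *)

Section Splitting.

Variables (d : nat -> nat) (D : nat).
Hypothesis D_gt0 : (0 < D)%N.

Definition partial_gcd (i : nat) : nat := gcdn D (range_prod d 1 i).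

(** Quotients of successive gcds, so that their products telescope to gcd(D, d_{1:i}). *)
Definition split_factor (i : nat) : nat := partial_gcd i %/ partial_gcd i.-1.

Lemma partial_gcd_gt0 i : (0 < partial_gcd i)%N.
Proof. by rewrite gcdn_gt0 D_gt0. Qed.

Lemma split_factorE i :
  (partial_gcd i.+1 = partial_gcd i * split_factor i.+1)%N.
Proof.
rewrite mulnC divnK // dvdn_gcd dvdn_gcdl range_prod1S dvdn_mulr //.
exact: dvdn_gcdr.
Qed.

Lemma range_prod_split i : range_prod split_factor 1 i = partial_gcd i.
Proof.
elim: i => [|i IHi]; first by rewrite range_prod10 /partial_gcd range_prod10 gcdn1.
by rewrite range_prod1S IHi split_factorE.
Qed.

Lemma split_factor_gt0 i : (0 < split_factor i.+1)%N.
Proof. by have := partial_gcd_gt0 i.+1; rewrite split_factorE muln_gt0 => /andP[]. Qed.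

(** Cancel gcd(D, d_{1:i}): the next gcd divides both D d_{i+1} and d_{1:i+1}, hence gcd(D, d_{1:i})
    d_{i+1}. *)
Lemma split_factor_dvd i : (split_factor i.+1 %| d i.+1)%N.
Proof.
rewrite -(dvdn_pmul2l (partial_gcd_gt0 i)) -split_factorE muln_gcdl dvdn_gcd.
rewrite -range_prod1S dvdn_gcdr andbT dvdn_mulr //; exact: dvdn_gcdl.
Qed.

(** With P = gcd(D, d_{1:i+1}), the quotients d_{1:i+1} / P and D / P are coprime; the first
    argument divides the former and the second divides the latter. *)
Lemma split_factor_coprime i j : (i < j)%N ->
  (forall k, (1 <= k <= j)%N -> (0 < d k)%N) ->
  coprime (d i.+1 %/ split_factor i.+1) (split_factor j.+1).
Proof.
move=> ltij d0.
set P := partial_gcd i.+1; have P0 : (0 < P)%N := partial_gcd_gt0 _.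
have cop : coprime (range_prod d 1 i.+1 %/ P) (D %/ P).
  rewrite /coprime -(eqn_pmul2l P0) muln_gcdr ![(P * (_ %/ _))%N]mulnC.
  by rewrite !divnK ?dvdn_gcdl ?dvdn_gcdr // gcdnC muln1.
apply: coprime_dvdl (coprime_dvdr _ cop).
  rewrite -(dvdn_pmul2l P0) [(P * (range_prod _ _ _ %/ _))%N]mulnC.
  rewrite divnK ?dvdn_gcdr //.
  rewrite {1}/P split_factorE range_prod1S -mulnA [(split_factor _ * _)%N]mulnC.
  by rewrite divnK ?split_factor_dvd // dvdn_pmul2r ?dvdn_gcdr ?d0.
rewrite -(dvdn_pmul2l P0) [(P * (D %/ _))%N]mulnC divnK ?dvdn_gcdl //.
apply: dvdn_trans (dvdn_gcdl D (range_prod d 1 j.+1)).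
rewrite -[gcdn _ _]/(partial_gcd j.+1) split_factorE dvdn_pmul2r ?split_factor_gt0 //.
rewrite /P -!range_prod_split (range_prod_cat _ ltij); exact: dvdn_mulr.
Qed.

End Splitting.

(** * Normalized vectors and the listed representatives *)

Section Representatives.

Variables (n : nat) (d : nat -> nat).
Hypothesis d_gt0 : forall i : nat, (1 <= i <= n)%N -> (0 < d i)%N.

Local Notation g := n.+1.
Implicit Types (v w : 'rV[int]_(g + g)).

(** The pair of indices 1 and g+1 is hyperbolic because d_{1:0} = 1. *)
Let e0 : 'rV[int]_(g + g) := row_mx (delta_mx 0 0) 0.
Let f0 : 'rV[int]_(g + g) := row_mx 0 (delta_mx 0 0).

Lemma mul_Lambda (x y : 'rV[int]_g) :
  row_mx x y *m Lambda g d = row_mx (- y *m Delta g d) (x *m Delta g d).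
Proof. by rewrite mul_row_block !mulmx0 add0r addr0 mulmxN mulNmx. Qed.

Lemma mul_DeltaE (x : 'rV[int]_g) i :
  (x *m Delta g d) 0 i = x 0 i * (range_prod d 1 i)%:Z.
Proof. by rewrite /Delta mul_mx_diag !mxE. Qed.

Lemma form_e0 v : form d v e0 = - v 0 (rshift g 0).
Proof.
rewrite -[v in LHS]hsubmxK /form mul_Lambda tr_row_mx mul_row_col trmx0 mulmx0 addr0 trmx_delta.
by rewrite -colE mxE mul_DeltaE !mxE range_prod10 mulr1.
Qed.

Lemma form_f0 v : form d v f0 = v 0 (lshift g 0).
Proof.
rewrite -[v in LHS]hsubmxK /form mul_Lambda tr_row_mx mul_row_col trmx0 mulmx0 add0r trmx_delta.
by rewrite -colE mxE mul_DeltaE mxE range_prod10 mulr1.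
Qed.

Lemma form_e0f0 : form d e0 f0 = 1.
Proof. by rewrite form_f0 row_mxEl mxE. Qed.

Lemma dvdn_divisor (k : nat) (x y : 'rV[int]_g) :
  (k %| divisor d (row_mx x y))%N <->
  forall i : 'I_g, (k %| (x 0 i)%R * (range_prod d 1 i)%:Z)%Z /\
                   (k %| (y 0 i)%R * (range_prod d 1 i)%:Z)%Z.
Proof.
rewrite /divisor mul_Lambda; split=> [/dvdn_content h i | h].
  have := h (lshift g i); have := h (rshift g i).
  by rewrite row_mxEl row_mxEr !mul_DeltaE mxE mulNr rpredN.
apply/dvdn_content=> i; case: (split_ordP i) => j ->.
  by rewrite row_mxEl mul_DeltaE mxE mulNr rpredN; case: (h j).
by rewrite row_mxEr mul_DeltaE; case: (h j).
Qed.

(** The listed shape with the individual D_i forgotten; a class modulo D contains at most one such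
    vector. *)
Definition normalized (D : nat) (v : 'rV[int]_(g + g)) : Prop :=
  [/\ v 0 (lshift g 0) = D%:Z, v 0 (rshift g 0) = 0
    & forall i : 'I_g, i != 0 ->
      0 <= v 0 (lshift g i) < D%:Z /\ 0 <= v 0 (rshift g i) < D%:Z].

Lemma normalized_congr_eq D v w r :
  normalized D v -> normalized D w -> w = v + D%:Z *: r -> v = w.
Proof.
move=> [v0 v0' vb] [w0 w0' wb] wE; apply/rowP=> i.
have small j : 0 <= v 0 j < D%:Z -> 0 <= w 0 j < D%:Z -> v 0 j = w 0 j.
  move=> vj wj; rewrite -(modz_small vj) -(modz_small wj) wE !mxE.
  by rewrite addrC mulrC modzMDl.
case: (split_ordP i) => j ->.
  have [-> | j0] := eqVneq j 0; first by rewrite v0 w0.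
  by apply: small; [case: (vb j j0) | case: (wb j j0)].
have [-> | j0] := eqVneq j 0; first by rewrite v0' w0'.
by apply: small; [case: (vb j j0) | case: (wb j j0)].
Qed.

(** The divisor is D_{1:n}: it divides the first entry [form d v f0]; conversely D_{1:n} = D_{1:i}
    D_{i+1:n} divides every entry times d_{1:i}, as D_{1:i} divides d_{1:i}. *)
Lemma is_rep_normalized v : is_rep d v ->
  (0 < divisor d v)%N /\ normalized (divisor d v) v.
Proof.
move=> [_ [D [a [[/= DP _] aP vE]]]].
have prodD (i : 'I_g) : range_prod D 1 n =
    (range_prod D 1 i * range_prod D i.+1 n)%N by rewrite -range_prod_cat // -ltnS.
have D_gt0 : (0 < range_prod D 1 n)%N.
  by apply: range_prod_gt0 (leqnn n) => i /DP[].
have bound (i : 'I_g) b : 0 <= b < (range_prod D 1 i)%:Z ->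
    0 <= (range_prod D i.+1 n)%:Z * b < (range_prod D 1 n)%:Z.
  by move: D_gt0; rewrite (prodD i); nia.
have norm : normalized (range_prod D 1 n) v.
  rewrite vE; split; rewrite ?row_mxEl ?row_mxEr ?mxE // => i i0.
  have i_gt0 : (0 < i)%N by rewrite lt0n.
  have [|ai ai'] := aP i.+1; first by rewrite ltnS i_gt0 ltn_ord.
  by rewrite row_mxEl row_mxEr !mxE !ifN -?lt0n //; split; apply: bound.
suff -> : divisor d v = range_prod D 1 n by [].
apply/eqP; rewrite eqn_dvd; apply/andP; split.
  by have := divisor_dvd d v f0; rewrite form_f0; case: norm => ->.
rewrite vE; apply/dvdn_divisor => i; rewrite !mxE.
have Dd : (range_prod D 1 i %| range_prod d 1 i)%N.
  by apply: range_prod_dvd (ltn_ord i : (i <= n)%N) => j /DP[].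
have dv b : (range_prod D 1 n %|
    (range_prod D i.+1 n)%:Z * b * (range_prod d 1 i)%:Z)%Z.
  rewrite (prodD i) mulrAC dvdz_mulr // mulrC -PoszM.
  exact: dvdn_mul.
case: ifP => [i0 | _]; last by split; exact: dv.
by split; [exact: dvdz_mulr | rewrite mul0r dvdz0].
Qed.

(** Divisibility by 0 means vanishing: with all d_{1:i} nonzero, divisor 0 would force content 0. *)
Lemma divisor_primitive_gt0 w : primitive w -> (0 < divisor d w)%N.
Proof.
rewrite -[w]hsubmxK => wP; rewrite lt0n; apply/eqP=> D0.
have /dvdn_divisor h : (0 %| divisor d (row_mx (lsubmx w) (rsubmx w)))%N by rewrite D0.
suff : (0 %| content (row_mx (lsubmx w) (rsubmx w)))%N by rewrite [content _]wP.
have cancel b (i : 'I_g) : (0%N %| b * (range_prod d 1 i)%:Z)%Z -> (0%N %| b)%Z.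
  have := range_prod_gt0 d_gt0 (ltn_ord i : (i <= n)%N).
  rewrite !dvd0z mulf_eq0 => ? /orP[//|]; lia.
apply/dvdn_content=> i; case: (split_ordP i) => j ->.
  by rewrite row_mxEl; apply: cancel (h j).1.
by rewrite row_mxEr; apply: cancel (h j).2.
Qed.

(** Each entry times d_{1:n} is a multiple of the divisor, and a Bezout combination of the entries
    is 1. *)
Lemma divisor_primitive_dvd w : primitive w -> (divisor d w %| range_prod d 1 n)%N.
Proof.
move=> wP; have [u] := content_bezout w; rewrite [content _]wP => wu.
suff : (divisor d w %| (range_prod d 1 n)%:Z * 1%:Z)%Z by rewrite mulr1.
rewrite -wu mxE mulr_sumr; apply: rpred_sum => i _.
rewrite mulrA dvdz_mulr //.
have := dvdnn (divisor d w); rewrite -{2}[w]hsubmxK => /dvdn_divisor h.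
have ext b (j : 'I_g) : (divisor d w %| b * (range_prod d 1 j)%:Z)%Z ->
    (divisor d w %| (range_prod d 1 n)%:Z * b)%Z.
  rewrite (range_prod_cat d (ltn_ord j : (j <= n)%N)) PoszM => ?; rewrite mulrC mulrA.
  exact: dvdz_mulr.
case: (split_ordP i) => j ->.
  by apply: (ext _ j); have := (h j).1; rewrite mxE.
by apply: (ext _ j); have := (h j).2; rewrite mxE.
Qed.

Lemma normalized_is_rep v :
  primitive v -> normalized (divisor d v) v -> is_rep d v.
Proof.
move=> vP [v0 v0' vb]; split=> //.
have D_gt0 := divisor_primitive_gt0 vP; have Dd := divisor_primitive_dvd vP.
have := dvdnn (divisor d v); rewrite -{2}[v]hsubmxK => /dvdn_divisor Dv.
move: (divisor d v) v0 vb D_gt0 Dd Dv => D v0 vb D_gt0 Dd Dv.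
pose F := split_factor d D.
have prodF i : range_prod F 1 i = partial_gcd d D i by exact: range_prod_split.
have prodFn : range_prod F 1 n = D by rewrite prodF; exact/gcdn_idPl.
have PQ (i : 'I_g) : D = (partial_gcd d D i * range_prod F i.+1 n)%N.
  by rewrite -prodF -{1}prodFn (range_prod_cat F (ltn_ord i : (i <= n)%N)).
(* [D] divides both [b * D] and b d_{1:i}, hence b gcd(D, d_{1:i}); cancelling the gcd leaves the
   divisibility of [b]. *)
have Qv b (i : 'I_g) : (D %| b * (range_prod d 1 i)%:Z)%Z ->
    (range_prod F i.+1 n %| b)%Z.
  rewrite !dvdzE abszM !absz_nat => Db.
  rewrite -(dvdn_pmul2l (partial_gcd_gt0 d D_gt0 i)) -PQ muln_gcdl dvdn_gcd.
  by rewrite dvdn_mulr // mulnC.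
(* Indices up to [g] serve the left half, larger ones the right half; [.-1] passes from 1-based
   indices to ordinals. *)
pose a k : int := if (k <= g)%N
  then ((v 0 (lshift g (inord k.-1)))%R %/ (range_prod F k n)%:Z)%Z
  else ((v 0 (rshift g (inord (k - g).-1)))%R %/ (range_prod F (k - g) n)%:Z)%Z.
have al (i : 'I_g) : a i.+1 = ((v 0 (lshift g i))%R %/ (range_prod F i.+1 n)%:Z)%Z.
  by rewrite /a ltn_ord /= inord_val.
have ar (i : 'I_g) :
    a (g + i.+1)%N = ((v 0 (rshift g i))%R %/ (range_prod F i.+1 n)%:Z)%Z.
  by rewrite /a ifN ?addKn /= ?inord_val //; lia.
have bound b (i : 'I_g) : 0 <= b < D%:Z ->
    0 <= (b %/ (range_prod F i.+1 n)%:Z)%Z < (range_prod F 1 i)%:Z.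
  move=> /andP[b0 bD].
  have Q0 : (0 < range_prod F i.+1 n)%N.
    by move: D_gt0; rewrite (PQ i) muln_gt0 => /andP[].
  by rewrite divz_ge0 // b0 /= ltz_divLR // prodF -PoszM -PQ bD.
exists F, a; split.
- split=> [[//|i] _ | [//|i] [//|j] _ ij jn].
    by rewrite split_factor_gt0 ?split_factor_dvd.
  apply/eqP/split_factor_coprime => // k /andP[k0 kj].
  by apply: d_gt0; rewrite k0 (leq_trans kj) // ltnW.
- move=> [//|i] /andP[i0 ig].
  have i_neq0 : Ordinal ig != 0 by rewrite -val_eqE /= -lt0n.
  have [vl vr] := vb _ i_neq0.
  by rewrite (al (Ordinal ig)) (ar (Ordinal ig)); split; apply: bound.
- apply/rowP=> k; case: (split_ordP k) => i ->; rewrite ?row_mxEl ?row_mxEr mxE.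
    have [i0|i0] := ifP.
      have -> : i = 0 by apply/val_inj/eqP.
      by rewrite v0 prodFn.
    rewrite al mulrC divzK //; apply: Qv; have := (Dv i).1; by rewrite mxE.
  have [i0|i0] := ifP.
    by have -> : i = 0 by apply/val_inj/eqP.
  rewrite ar mulrC divzK //; apply: Qv; have := (Dv i).2; by rewrite mxE.
Qed.

Lemma exists_normalized w : primitive w ->
  exists v, [/\ normalized (divisor d w) v, primitive v & same_orbit d w v].
Proof.
move=> wP; have D_gt0 := divisor_primitive_gt0 wP.
have := dvdnn (divisor d w); rewrite -{2}[w]hsubmxK => /dvdn_divisor /(_ 0).
set D := divisor d w in D_gt0 *.
rewrite range_prod10 !mulr1 !mxE => -[Dl Dr].
(* Entries 1 and g+1 of [w] are multiples of [D], so putting [D] and 0 there respects the class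
   modulo [D]. *)
pose v : 'rV[int]_(g + g) := row_mx
  (\row_i if i == 0 then D%:Z else ((w 0 (lshift g i))%R %% D)%Z)
  (\row_i if i == 0 then 0 else ((w 0 (rshift g i))%R %% D)%Z).
have vD : normalized D v.
  rewrite /v; split; rewrite ?row_mxEl ?row_mxEr ?mxE // => i i0.
  rewrite row_mxEl row_mxEr !mxE (negbTE i0) !modz_ge0 ?ltz_pmod //; lia.
have [r vE] : exists r, v = w + D%:Z *: r.
  exists (\row_i ((v 0 i - w 0 i)%R %/ D)%Z); apply/rowP=> i.
  rewrite !mxE [X in _ + X]mulrC divzK ?subrKC //.
  case: (split_ordP i) => j ->; rewrite ?row_mxEl ?row_mxEr mxE.
    have [-> | _] := eqVneq j 0; first by rewrite rpredB.
    by rewrite -eqz_mod_dvd modz_mod.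
  have [-> | _] := eqVneq j 0; first by rewrite rpredB ?dvdz0.
  by rewrite -eqz_mod_dvd modz_mod.
clearbody v; exists v; split=> //; last first.
  apply: (orbit_reduce form_e0f0 D_gt0 vE).
    by rewrite form_f0; case: vD.
  by rewrite form_e0; case: vD => _ -> _; rewrite oppr0.
(* [content v] divides the first entry [D] of [v], hence all of [w = v - D r]. *)
suff : (content v %| content w)%N by rewrite [content w]wP dvdn1 => /eqP.
have /dvdn_content cv := dvdnn (content v).
apply/dvdn_content=> i.
have -> : w = v - D%:Z *: r by rewrite vE addrK.
rewrite mxE [X in _ + X]mxE rpredB // mxE dvdz_mulr //.
by have := cv (lshift g 0); case: vD => ->.
Qed.

End Representatives.

Theorem corollary4p2 (g : nat) (d : nat -> nat)
    (hg : (0 < g)%N)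
    (hd : forall i : nat, (1 <= i <= g.-1)%N -> (0 < d i)%N) :
  forall w : 'rV[int]_(g + g), primitive w ->
    exists! v : 'rV[int]_(g + g), is_rep d v /\ same_orbit d w v.
Proof.
case: g => [//|n] in hg hd * => w wP.
have [v [vD vP wv]] := exists_normalized hd wP.
exists v; split=> [|v' [/is_rep_normalized[_ vD'] wv']].
  by split=> //; apply: normalized_is_rep => //; rewrite (divisor_orbit wv).
have D_gt0 := divisor_primitive_gt0 hd wP.
(* Both normalized vectors are congruent to [w], hence to each other, modulo its divisor. *)
have [r vE] := orbit_congr D_gt0 wv.
have [r' vE'] := orbit_congr D_gt0 wv'.
rewrite (divisor_orbit wv') in vD'.
apply: (normalized_congr_eq (r := r' - r) vD vD').
by rewrite vE vE'; apply/rowP=> i; rewrite !mxE; ring.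
Qed.
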